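(* Let $n\ge 4$ and let $(\pi,V)$ be a real representation of the alternating group $A_n$. Put $h_\pi=\frac{\chi_\pi(1)-\chi_\pi(s_1s_3)}{2}$, where $s_1s_3=(1,2)(3,4)$. Then $\pi$ is spinorial if and only if $h_\pi$ is a multiple of $4$. In this case $\pi$ has a unique lift.
   Context: A real representation of a finite group $G$ on a Euclidean space $V$ is regarded as a homomorphism $\pi:G\to\mathrm{O}(V)$; $\chi_\pi$ is its character. $\mathrm{Pin}(V)$ is the Pin group of $V$ (from the Clifford algebra with $v^2=-|v|^2$) with standard double cover $\rho:\mathrm{Pin}(V)\to\mathrm{O}(V)$, kernel $\{\pm1\}$. $\pi$ is spinorial if there is a homomorphism $\hat\pi:G\to\mathrm{Pin}(V)$ (a lift) with $\rho\circ\hat\pi=\pi$. *)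

(* Defs.v *)
From HB Require Import structures.
From mathcomp Require Import all_boot all_order all_algebra all_fingroup all_solvable.
From mathcomp Require Import reals.
Set Implicit Arguments.
Unset Strict Implicit.
Unset Printing Implicit Defensive.
Import Order.TTheory GRing.Theory Num.Theory.
Local Open Scope ring_scope.

(* The Clifford algebra Cl(R^d) of the Euclidean space R^d (standard inner   *)
(* product), with the convention v^2 = - |v|^2.  Elements are coordinate     *)
(* functions on the basis e_A, A a subset of {0,..,d-1},                     *)
(* e_A = e_{a1} ... e_{ak} (a1 < ... < ak).                                  *)
Section Clifford.
Variables (R : realType) (d : nat).

Local Notation cl := {ffun {set 'I_d} -> R}.

Definition clbasis (A : {set 'I_d}) : cl := [ffun B => (B == A)%:R].

(* e_A e_B = (-1)^(#{(a,b) in A x B | b < a} + #|A :&: B|) e_(A symdiff B) *)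
Definition clsign (A B : {set 'I_d}) : R :=
  (-1) ^+ (#|[set p : ('I_d * 'I_d)%type | (p.1 \in A) && (p.2 \in B) && (nat_of_ord p.2 < nat_of_ord p.1)%N]|
           + #|A :&: B|).

Definition clsymdiff (A B : {set 'I_d}) : {set 'I_d} := (A :\: B) :|: (B :\: A).

Definition clmul (x y : cl) : cl :=
  [ffun C : {set 'I_d} => \sum_(A : {set 'I_d}) \sum_(B : {set 'I_d})
     (clsymdiff A B == C)%:R * (x A * y B * clsign A B)].

Definition clone : cl := clbasis set0.

Definition clvec (v : 'cV[R]_d) : cl := [ffun A : {set 'I_d} => \sum_(i < d) (A == [set i])%:R * v i 0].

Definition clalpha (x : cl) : cl := [ffun A : {set 'I_d} => (-1) ^+ #|A| * x A].

Definition unit_vec (v : 'cV[R]_d) : Prop := \sum_(i < d) v i 0 ^+ 2 = 1.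

Definition Pin : cl -> Prop := fun x =>
  exists s : seq 'cV[R]_d, (forall v, v \in s -> unit_vec v) /\
                          x = foldr clmul clone (map clvec s).

(* The standard double cover rho : Pin(V) -> O(V),
   rho(x)(w) = alpha(x) w x^{-1}.  "rho x = M" (for an orthogonal matrix M
   acting on column vectors) is expressed without inverses as
   alpha(x) w = (M w) x for all w, which is equivalent since x is invertible. *)
Definition rho_is (x : cl) (M : 'M[R]_d) : Prop :=
  forall w : 'cV[R]_d, clmul (clalpha x) (clvec w) = clmul (clvec (M *m w)) x.

End Clifford.

Definition orthogonal_mx (R : realType) d (M : 'M[R]_d) : Prop := M *m M^T = 1%:M.

Definition real_orth_rep (R : realType) (gT : finGroupType) (G : {set gT}) d
    (pi : gT -> 'M[R]_d) : Prop :=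
  [/\ pi 1%g = 1%:M,
      forall g h, g \in G -> h \in G -> pi (g * h)%g = pi g *m pi h
    & forall g, g \in G -> orthogonal_mx (pi g)].

Definition rep_char (R : realType) d (gT : finGroupType) (pi : gT -> 'M[R]_d) (g : gT) : R :=
  \tr (pi g).

Definition is_lift (R : realType) (gT : finGroupType) (G : {set gT}) d
    (pi : gT -> 'M[R]_d) (phi : gT -> {ffun {set 'I_d} -> R}) : Prop :=
  [/\ forall g, g \in G -> Pin (phi g),
      forall g h, g \in G -> h \in G -> phi (g * h)%g = clmul (phi g) (phi h)
    & forall g, g \in G -> rho_is (phi g) (pi g)].

Definition spinorial (R : realType) (gT : finGroupType) (G : {set gT}) d
    (pi : gT -> 'M[R]_d) : Prop :=
  exists phi, is_lift G pi phi.

(* The element s1 s3 = (1,2)(3,4) of A_n (points 1..4 are the ordinals 0..3) *)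
Lemma Defs_lt_of_3lt (n i : nat) : (i <= 3)%N -> (3 < n)%N -> (i < n)%N.
Proof. by move=> hi hn; apply: leq_ltn_trans hn. Qed.

Definition s1s3 (n : nat) (hn : (3 < n)%N) : {perm 'I_n} :=
  (tperm (Ordinal (@Defs_lt_of_3lt n 0 isT hn)) (Ordinal (@Defs_lt_of_3lt n 1 isT hn)) *
   tperm (Ordinal (@Defs_lt_of_3lt n 2 isT hn)) (Ordinal (@Defs_lt_of_3lt n 3 isT hn)))%g.

(* Main.v *)
Require Import Defs.
From HB Require Import structures.
From mathcomp Require Import all_boot all_order all_algebra all_fingroup all_solvable.
From mathcomp Require Import boolp reals ring zify.
Import Order.TTheory GRing.Theory Num.Theory.
Local Open Scope ring_scope.
Set Implicit Arguments.
Unset Strict Implicit.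
Unset Printing Implicit Defensive.

(**
  The preimage of [pi(A_n)] in the Pin group, pulled back to [A_n], is an
  extension of [A_n] by signs, and the question is whether it splits.  If the
  involution [pi ((1,2)(3,4))] has a (-1)-eigenspace of dimension [h], each of
  its lifts [x] satisfies [x^2 = (-1)^(h(h+1)/2)], and [h] is even because
  [A_n] is generated by elements of order 3, whose lifts can be normalised to
  have cube 1; hence a lift forces [4 | h].

  Conversely, suppose that the lifts of [(1,2)(3,4)], hence those of all
  [t_k = (1,2)(k-1,k)], have square 1.  A homomorphic lift is built along
  [A_3 < A_4 < ...], using [A_k = A_(k-1) u A_(k-1) t_k A_(k-1)]: given a lift
  [f] of [A_(k-1)], choose the lift [y] of [t_k] such that
  [(y f(t_(k-1)))^3 = 1].  Then [f(A_(k-1)) u f(A_(k-1)) y f(A_(k-1))] is closed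
  under products: conjugation by [y] agrees with [f] on [A_(k-2)], which is
  normalised by [t_k], by uniqueness of lifts there, and the braid relation
  [y f(t_(k-1)) y = f(t_(k-1)) y f(t_(k-1))] handles the remaining double coset.
  Uniqueness holds since elements of order 3 have a unique lift of cube 1.
*)

(** * The Clifford algebra and the Pin group *)

Section CliffordRing.
Variables (R : realType) (d : nat).
Implicit Types (A B C D : {set 'I_d}) (v w : 'cV[R]_d).

(** * Signs of products of basis elements *)

Lemma in_clsymdiff A B i : (i \in clsymdiff A B) = (i \in A) (+) (i \in B).
Proof. by rewrite !inE; case: (i \in A); case: (i \in B). Qed.

Lemma clsymdiffA : associative (@clsymdiff d).
Proof. by move=> A B C; apply/setP=> i; rewrite !in_clsymdiff addbA. Qed.

Lemma clsymdiffC : commutative (@clsymdiff d).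
Proof. by move=> A B; apply/setP=> i; rewrite !in_clsymdiff addbC. Qed.

Lemma clsymdiff0 A : clsymdiff A set0 = A.
Proof. by apply/setP=> i; rewrite in_clsymdiff inE addbF. Qed.

Lemma clsymdiff0l A : clsymdiff set0 A = A.
Proof. by apply/setP=> i; rewrite in_clsymdiff inE. Qed.

Lemma clsymdiffK A : involutive (clsymdiff A).
Proof. by move=> B; apply/setP=> i; rewrite !in_clsymdiff addKb. Qed.

Lemma clsymdiff_eq A B C : (clsymdiff A B == C) = (B == clsymdiff A C).
Proof. by apply/eqP/eqP=> [<-|->]; rewrite clsymdiffK. Qed.

(** Pairs with [j < i] and common elements, counted separately in [clsign], merge into pairs with
    [j <= i]; in product form the sign is visibly multiplicative in each argument under symmetric
    difference. *)
Lemma clsignE A B :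
  clsign R A B = \prod_(i in A) \prod_(j in B) (-1) ^+ (j <= i)%N.
Proof.
rewrite pair_big_dep /= prodrXr /clsign; congr (_ ^+ _).
transitivity (\sum_(p : 'I_d * 'I_d | (p.1 \in A) && (p.2 \in B))
  ((p.2 < p.1)%N + (p.2 == p.1)%N))%N; last first.
  apply: eq_bigr => -[i j] _ /=; rewrite -(inj_eq val_inj) /=.
  by case: (ltngtP (nat_of_ord j) i).
rewrite big_split /=; congr (_ + _)%N.
  rewrite -sum1dep_card big_mkcondr; apply: eq_bigr => p _; by case: ifP.
rewrite -sum1_card.
rewrite -(pair_big_dep (fun i => i \in A) (fun _ j => j \in B)
  (fun i j : 'I_d => nat_of_bool (j == i))) /=.
rewrite (eq_bigl (fun i => (i \in A) && (i \in B))); last by move=> i; rewrite inE.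
rewrite big_mkcondr; apply: eq_bigr => i _ /=.
rewrite [RHS]big_mkcond (bigD1 i) //= eqxx big1.
  by case: (i \in B); rewrite ?addn0.
by move=> j /negPf->; case: ifP.
Qed.

Lemma prod_clsymdiff (F : 'I_d -> R) A B : (forall i, F i * F i = 1) ->
  \prod_(i in clsymdiff A B) F i = \prod_(i in A) F i * \prod_(i in B) F i.
Proof.
move=> F1; rewrite !(big_mkcond (fun i => i \in _)) -big_split /=.
apply: eq_bigr => i _; rewrite in_clsymdiff.
by case: (i \in A); case: (i \in B); rewrite ?mulr1 ?mul1r ?F1.
Qed.

Lemma clsignDl A A' B :
  clsign R (clsymdiff A A') B = clsign R A B * clsign R A' B.
Proof.
rewrite !clsignE prod_clsymdiff // => i; rewrite -big_split big1 //= => j _.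
by rewrite -expr2 sqrr_sign.
Qed.

Lemma clsignDr A B B' :
  clsign R A (clsymdiff B B') = clsign R A B * clsign R A B'.
Proof.
rewrite !clsignE -big_split; apply: eq_bigr => i _; rewrite prod_clsymdiff //.
by move=> j; rewrite -expr2 sqrr_sign.
Qed.

Lemma clsign0l A : clsign R set0 A = 1.
Proof. by rewrite clsignE big_set0. Qed.

Lemma clsign0r A : clsign R A set0 = 1.
Proof. by rewrite clsignE big1 // => i _; rewrite big_set0. Qed.

Lemma clsymdiffxx A : clsymdiff A A = set0.
Proof. by apply/setP=> i; rewrite in_clsymdiff addbb inE. Qed.

Lemma clsign_sqr A B : clsign R A B * clsign R A B = 1.
Proof. by rewrite -clsignDr clsymdiffxx clsign0r. Qed.

Lemma sum_pick (P : {set 'I_d}) (F : {set 'I_d} -> R) :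
  \sum_C (C == P)%:R * F C = F P.
Proof.
rewrite (bigD1 P) //= eqxx mul1r big1 ?addr0 // => C /negPf->.
by rewrite mul0r.
Qed.

(** * The ring and algebra structure *)

Lemma clmul_sumE (x y : {ffun {set 'I_d} -> R}) C :
  clmul x y C =
  \sum_A x A * y (clsymdiff A C) * clsign R A (clsymdiff A C).
Proof.
rewrite ffunE; apply: eq_bigr => A _.
under eq_bigr do rewrite clsymdiff_eq.
exact: (sum_pick _ (fun B => x A * y B * clsign R A B)).
Qed.

(* [{ffun _ -> R}] already carries the pointwise product, hence the alias. *)
Definition clifford := {ffun {set 'I_d} -> R}.

HB.instance Definition _ := GRing.Lmodule.copy clifford {ffun {set 'I_d} -> R^o}.

Fact clmulA : associative (@clmul R d).
Proof.
move=> x y z; apply/ffunP => D; rewrite clmul_sumE [RHS]clmul_sumE.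
under eq_bigr => A _ do rewrite clmul_sumE mulr_sumr mulr_suml.
under [RHS]eq_bigr => C _ do rewrite clmul_sumE !mulr_suml.
rewrite [RHS]exchange_big; apply: eq_bigr => A _ /=.
rewrite [RHS](reindex_inj (inv_inj (clsymdiffK A))) /=.
apply: eq_bigr => B _; rewrite clsymdiffK -!clsymdiffA !(clsignDl, clsignDr).
rewrite (_ : clsymdiff B (clsymdiff A D) = clsymdiff A (clsymdiff B D)).
  (* Once the signs are expanded, the right-hand side contains two more factors [clsign A B] than
     the left-hand side. *)
  by rewrite -[LHS]mulr1 -(clsign_sqr A B); ring.
by apply/setP=> i; rewrite !in_clsymdiff addbCA.
Qed.

Fact clmul1l : left_id (clone R d) (@clmul R d).
Proof.
move=> x; apply/ffunP => D; rewrite clmul_sumE.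
under eq_bigr do rewrite ffunE -mulrA.
by rewrite sum_pick clsymdiff0l clsign0l mulr1.
Qed.

Fact clmul1r : right_id (clone R d) (@clmul R d).
Proof.
move=> x; apply/ffunP => D; rewrite clmul_sumE.
under eq_bigr => A _.
  rewrite ffunE clsymdiff_eq clsymdiff0 eq_sym mulrAC mulrC; over.
by rewrite (sum_pick D) clsymdiffxx clsign0r mulr1.
Qed.

Fact clmulDl : left_distributive (@clmul R d) +%R.
Proof.
move=> x y z; apply/ffunP => D; rewrite clmul_sumE [RHS]ffunE !clmul_sumE -big_split.
by apply: eq_bigr => A _; rewrite ffunE !mulrDl.
Qed.

Fact clmulDr : right_distributive (@clmul R d) +%R.
Proof.
move=> x y z; apply/ffunP => D; rewrite clmul_sumE [RHS]ffunE !clmul_sumE -big_split.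
by apply: eq_bigr => A _; rewrite ffunE mulrDr mulrDl.
Qed.

Fact clone_neq0 : clone R d != 0 :> clifford.
Proof.
by apply/eqP => /ffunP/(_ set0)/eqP; rewrite !ffunE eqxx oner_eq0.
Qed.

HB.instance Definition _ := GRing.Zmodule_isNzRing.Build clifford
  clmulA clmul1l clmul1r clmulDl clmulDr clone_neq0.

Lemma clmulE (x y : clifford) : clmul x y = x * y. Proof. by []. Qed.

Lemma clscaleE (a : R) (x : clifford) A : (a *: x) A = a * x A.
Proof. by rewrite ffunE. Qed.

Fact clscaleAl (a : R) (x y : clifford) : a *: (x * y) = (a *: x) * y.
Proof.
apply/ffunP => D; rewrite clscaleE -!clmulE !clmul_sumE mulr_sumr.
by apply: eq_bigr => A _; rewrite clscaleE !mulrA.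
Qed.

HB.instance Definition _ := GRing.Lmodule_isLalgebra.Build R clifford clscaleAl.

Fact clscaleAr (a : R) (x y : clifford) : a *: (x * y) = x * (a *: y).
Proof.
apply/ffunP => D; rewrite clscaleE -!clmulE !clmul_sumE mulr_sumr.
by apply: eq_bigr => A _; rewrite clscaleE; ring.
Qed.

HB.instance Definition _ := GRing.Lalgebra_isAlgebra.Build R clifford clscaleAr.

(** * Vectors and the Clifford relation *)

Local Notation vec v := (clvec v : clifford).

Lemma clvec_sum (v : 'cV[R]_d) :
  vec v = \sum_i v i 0 *: (clbasis R [set i] : clifford).
Proof.
apply/ffunP => A; rewrite sum_ffunE ffunE; apply: eq_bigr => i _.
by rewrite clscaleE ffunE mulrC.
Qed.

Lemma clvecD v w : vec (v + w) = vec v + vec w.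
Proof.
by rewrite !clvec_sum -big_split; apply: eq_bigr => i _; rewrite mxE scalerDl.
Qed.

Lemma clvecZ a v : vec (a *: v) = a *: vec v.
Proof.
by rewrite !clvec_sum scaler_sumr; apply: eq_bigr => i _; rewrite mxE scalerA.
Qed.

Lemma clvec_delta (i : 'I_d) : vec (delta_mx i 0) = clbasis R [set i].
Proof.
rewrite clvec_sum (bigD1 i) //= mxE !eqxx scale1r big1 ?addr0 // => j ji.
by rewrite mxE (negPf ji) scale0r.
Qed.

Lemma clbasis_mul A B :
  (clbasis R A : clifford) * (clbasis R B : clifford) =
  clsign R A B *: (clbasis R (clsymdiff A B) : clifford).
Proof.
apply/ffunP => D; rewrite -clmulE clmul_sumE clscaleE ffunE.
under eq_bigr do rewrite ffunE -mulrA.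
by rewrite sum_pick ffunE clsymdiff_eq mulrC; case: eqP => [->|]; rewrite ?mulr0 // clsymdiffK.
Qed.

Definition dotc (v w : 'cV[R]_d) : R := \sum_i v i 0 * w i 0.

Lemma clsign1 (i j : 'I_d) : clsign R [set i] [set j] = (-1) ^+ (j <= i)%N.
Proof. by rewrite clsignE !big_set1. Qed.

Lemma clvec_anticomm v w : vec v * vec w + vec w * vec v = (- 2 * dotc v w)%:A.
Proof.
(* By bilinearity basis vectors suffice: distinct ones anticommute, since exactly one of [i <= j]
   and [j <= i] holds, and each squares to -1. *)
have e2 i j : (clbasis R [set i] : clifford) * clbasis R [set j] +
    (clbasis R [set j] : clifford) * clbasis R [set i] = ((i == j)%:R * - 2)%:A :> clifford.
  rewrite !clbasis_mul !clsign1; have [->|ij] := eqVneq.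
    by rewrite leqnn clsymdiffxx -scalerDl mul1r; congr (_ *: _); ring.
  rewrite mul0r scale0r; apply/ffunP => A; rewrite ffunE !clscaleE !ffunE.
  rewrite (_ : clsymdiff [set j] _ = clsymdiff [set i] [set j]); last first.
    by apply/setP => k; rewrite !in_clsymdiff addbC.
  move: ij; rewrite -(inj_eq val_inj) /=.
  by case: (ltngtP (nat_of_ord i) j) => //= _ _; ring.
rewrite !clvec_sum !mulr_suml /dotc mulr_sumr scaler_suml.
transitivity (\sum_i \sum_j ((j == i)%:R * (-2 * (v i 0 * w j 0)))%:A : clifford).
  under eq_bigr do rewrite mulr_sumr.
  under [X in _ + X]eq_bigr do rewrite mulr_sumr.
  rewrite [X in _ + X]exchange_big -big_split /=.
  apply: eq_bigr => i _; rewrite -big_split; apply: eq_bigr => j _ /=.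
  rewrite -!scalerAl -!scalerAr !scalerA [w j 0 * _]mulrC -scalerDr e2 scalerA.
  by congr (_ *: _); rewrite eq_sym; ring.
apply: eq_bigr => i _; rewrite (bigD1 i) //= eqxx mul1r big1 ?addr0 // => j ji.
by rewrite (negPf ji) mul0r scale0r.
Qed.

Lemma unit_vecE v : unit_vec v <-> dotc v v = 1.
Proof. by rewrite /unit_vec /dotc; under eq_bigr do rewrite expr2. Qed.

Lemma clvec_sqr v : unit_vec v -> vec v * vec v = -1.
Proof.
move=> /unit_vecE v1; have := clvec_anticomm v v; rewrite v1 mulr1 -mulr2n.
move=> h; apply: (scalerI (a := 2 : R)); first by rewrite pnatr_eq0.
by rewrite scalerN scaler_nat h scaleNr.
Qed.

(** * The parity automorphism and products of unit vectors *)

Local Notation alpha x := (clalpha x : clifford).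

Lemma clalphaM (x y : clifford) : alpha (x * y) = alpha x * alpha y.
Proof.
apply/ffunP => D; rewrite [RHS]clmul_sumE ffunE clmul_sumE mulr_sumr.
apply: eq_bigr => A _; rewrite !ffunE.
have -> : (-1) ^+ #|D| = (-1) ^+ #|A| * (-1) ^+ #|clsymdiff A D| :> R.
  have signE B : (-1) ^+ #|B| = \prod_(i in B) -1 :> R by rewrite prodr_const.
  rewrite !signE -prod_clsymdiff ?clsymdiffK // => i.
  by rewrite mulrNN mulr1.
ring.
Qed.

Lemma clalphaV v : alpha (clvec v) = - vec v.
Proof.
apply/ffunP => D; rewrite !ffunE mulr_sumr -sumrN; apply: eq_bigr => i _.
by case: eqP => [->|_]; rewrite ?mul0r ?mulr0 ?oppr0 // cards1 expr1 mulN1r.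
Qed.

Lemma clalpha1 : alpha (1 : clifford) = 1.
Proof.
apply/ffunP => D; rewrite !ffunE; case: eqP => [->|_].
  by rewrite cards0 expr0 mulr1.
by rewrite mulr0.
Qed.

Lemma clalphaN (x : clifford) : alpha (- x) = - alpha x.
Proof. by apply/ffunP => D; rewrite !ffunE mulrN. Qed.

Local Notation Pin x := (@Pin R d x).

Definition vecprod (s : seq 'cV[R]_d) : clifford := \prod_(v <- s) vec v.

Lemma vecprodE s : foldr (@clmul R d) (clone R d) (map (@clvec R d) s) = vecprod s.
Proof. by rewrite /vecprod; elim: s => [|v s IH]; rewrite ?big_nil //= IH big_cons. Qed.

Lemma PinP (x : clifford) :
  Pin x <-> exists2 s, (forall v, v \in s -> unit_vec v) & x = vecprod s.
Proof.
split=> [[s [s1 ->]]|[s s1 ->]]; exists s => //; first exact: vecprodE.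
by rewrite -vecprodE.
Qed.

Lemma Pin_vec v : unit_vec v -> Pin (clvec v).
Proof.
move=> v1; apply/PinP; exists [:: v]; last by rewrite /vecprod big_seq1.
by move=> w; rewrite inE => /eqP->.
Qed.

Lemma Pin1 : Pin (1 : clifford).
Proof. by apply/PinP; exists [::]; rewrite // /vecprod big_nil. Qed.

Lemma PinM (x y : clifford) : Pin x -> Pin y -> Pin (x * y : clifford).
Proof.
move=> /PinP[s s1 ->] /PinP[t t1 ->]; apply/PinP; rewrite -clmulE.
exists (s ++ t); last by rewrite /vecprod big_cat.
by move=> v; rewrite mem_cat => /orP[/s1|/t1].
Qed.

Lemma clalpha_vecprod s : alpha (vecprod s) = (-1) ^+ size s * vecprod s.
Proof.
rewrite /vecprod; elim: s => [|v s IH].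
  by rewrite big_nil mul1r clalpha1.
rewrite big_cons clalphaM IH clalphaV /= exprS !mulNr mul1r !mulrA.
by rewrite (commr_sign (vec v)).
Qed.

Lemma unit_vecN v : unit_vec v -> unit_vec (- v).
Proof.
by rewrite /unit_vec => <-; apply: eq_bigr => i _; rewrite mxE sqrrN.
Qed.

Lemma clvecN v : vec (- v) = - vec v.
Proof. by rewrite -scaleN1r clvecZ scaleN1r. Qed.

(** Since [v * - v = 1] for a unit vector, the reversed product of the opposite vectors is an
    inverse. *)
Lemma Pin_inv (x : clifford) : Pin x ->
  exists y : clifford, [/\ Pin y, x * y = 1 & y * x = 1].
Proof.
case/PinP => s s1 ->{x}; elim: s s1 => [|v s IH] s1.
  by exists 1; rewrite /vecprod big_nil mulr1; split=> //; exact: Pin1.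
have v1 : unit_vec v by apply: s1; rewrite mem_head.
case: IH => [w ws|y [Py xy yx]]; first by apply: s1; rewrite inE ws orbT.
exists (y * vec (- v)); split.
- by apply: PinM => //; apply/Pin_vec/unit_vecN.
- rewrite /vecprod big_cons -/(vecprod s) -mulrA (mulrA (vecprod s)) xy mul1r.
  by rewrite clvecN mulrN clvec_sqr // opprK.
- rewrite /vecprod big_cons -/(vecprod s) -mulrA (mulrA (vec (- v))).
  by rewrite clvecN mulNr clvec_sqr // opprK mul1r.
Qed.

(** * The coefficient inner product and the kernel of the cover *)

Definition cldot (x y : clifford) : R := \sum_A x A * y A.

Lemma cldotC x y : cldot x y = cldot y x.
Proof. by apply: eq_bigr => A _; rewrite mulrC. Qed.

Lemma cldotZl a x z : cldot (a *: x) z = a * cldot x z.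
Proof.
by rewrite /cldot mulr_sumr; apply: eq_bigr => A _; rewrite clscaleE mulrA.
Qed.

Lemma clbasis_mull A (x : clifford) D :
  ((clbasis R A : clifford) * x) D =
  clsign R A (clsymdiff A D) * x (clsymdiff A D).
Proof.
rewrite -clmulE clmul_sumE; under eq_bigr do rewrite ffunE -mulrA.
by rewrite sum_pick mulrC.
Qed.

Lemma clbasis_mulr A (x : clifford) D :
  (x * (clbasis R A : clifford)) D =
  clsign R (clsymdiff A D) A * x (clsymdiff A D).
Proof.
rewrite -clmulE clmul_sumE; under eq_bigr => B _.
  rewrite ffunE clsymdiffC clsymdiff_eq clsymdiffC mulrAC mulrC; over.
by rewrite (sum_pick (clsymdiff A D)) clsymdiffC clsymdiffK mulrC.
Qed.

(** Multiplication by [e_i] exchanges [e_A] and [e_(clsymdiff [set i] A)] up to signs, and these two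
    signs are opposite because [e_i] squares to -1. *)
Lemma cldot_basis1 i (x y : clifford) :
  cldot ((clbasis R [set i] : clifford) * x) y =
  - cldot x ((clbasis R [set i] : clifford) * y).
Proof.
rewrite /cldot (reindex_inj (inv_inj (clsymdiffK [set i]))) /= -sumrN.
apply: eq_bigr => A _; rewrite !clbasis_mull clsymdiffK clsignDr clsign1 leqnn.
by rewrite expr1; ring.
Qed.

Lemma cldot_vec v (x y : clifford) :
  cldot (vec v * x) y = - cldot x (vec v * y).
Proof.
rewrite clvec_sum !mulr_suml [RHS](congr1 -%R (cldotC _ _)).
have sumE (F : 'I_d -> clifford) z : cldot (\sum_i F i) z = \sum_i cldot (F i) z.
  rewrite /cldot exchange_big; apply: eq_bigr => A _.
  by rewrite sum_ffunE mulr_suml.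
rewrite !sumE -sumrN; apply: eq_bigr => i _.
by rewrite -!scalerAl !cldotZl cldot_basis1 mulrN cldotC.
Qed.

(** Left multiplication by a unit vector is skew-adjoint with square -1, hence an isometry. This
    norm confines the scalars in [Pin] to 1 and -1. *)
Lemma Pin_norm (x : clifford) : Pin x -> cldot x x = 1.
Proof.
case/PinP => s s1 ->{x}; elim: s s1 => [|v s IH] s1.
  rewrite /vecprod big_nil /cldot; under eq_bigr do rewrite [X in X * _]ffunE.
  by rewrite sum_pick ffunE eqxx.
rewrite /vecprod big_cons -/(vecprod s) cldot_vec mulrA.
rewrite clvec_sqr ?mulN1r; last by apply: s1; rewrite mem_head.
rewrite cldotC -scaleN1r cldotZl mulN1r opprK IH // => w ws.
by apply: s1; rewrite inE ws orbT.
Qed.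

(* The coefficient of [e_A] on both sides differs by [(-1)^([i \in A])]. *)
Lemma clalpha_central (z : clifford) :
  (forall w, alpha z * vec w = vec w * z) -> exists a : R, z = a%:A.
Proof.
move=> zc; exists (z set0); apply/ffunP => A; rewrite clscaleE ffunE.
case: eqP => [->|/eqP/set0Pn[i iA]]; rewrite ?mulr1 ?mulr0 //.
have /ffunP/(_ (clsymdiff [set i] A)) := zc (delta_mx i 0).
rewrite clvec_delta clbasis_mull clbasis_mulr clsymdiffK ffunE.
have signC : clsign R [set i] A = (-1) ^+ #|A| * -1 * clsign R A [set i].
  have -> : (-1) ^+ #|A| = \prod_(j in A) -1 :> R by rewrite prodr_const.
  have -> : clsign R A [set i] = \prod_(j in A) (-1) ^+ (i <= j)%N.
    by rewrite clsignE; apply: eq_bigr => j _; rewrite big_set1.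
  rewrite clsignE big_set1.
  rewrite mulrAC -big_split (bigD1 i) //= [in RHS](bigD1 i) //= leqnn.
  rewrite [in RHS]mulrAC; congr (_ * _); first ring.
  apply: eq_bigr => j /andP[_]; rewrite -(inj_eq val_inj) /=.
  by case: (ltngtP (nat_of_ord i) j) => //= _ _; ring.
rewrite signC => h; have h' : 2 * (clsign R A [set i] * ((-1) ^+ #|A| * z A)) = 0.
  by rewrite mulr_natl mulr2n {1}h; ring.
by move/eqP: h'; rewrite !mulf_eq0 pnatr_eq0 !signr_eq0 => /eqP ->.
Qed.

Lemma scalar_Pin (a : R) : Pin (a%:A : clifford) -> a = 1 \/ a = -1.
Proof.
move/Pin_norm; rewrite cldotZl cldotC cldotZl [cldot _ _](Pin_norm Pin1) mulr1.
by rewrite -expr2 => /eqP; rewrite sqrf_eq1 => /orP[] /eqP; [left|right].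
Qed.

(** The quotient [z = x * y^-1] covers the identity, so it is a scalar by [clalpha_central], and a
    scalar in [Pin] is a sign. *)
Lemma rho_is_uniq (M : 'M[R]_d) (x y : clifford) : M \in unitmx ->
  Pin x -> Pin y -> rho_is x M -> rho_is y M -> x = y \/ x = - y.
Proof.
move=> Mu Px Py xM yM; have [y' [Py' yy' y'y]] := Pin_inv Py.
have y'M w : alpha y' * vec w = vec (invmx M *m w) * y'.
  have := yM (invmx M *m w); rewrite mulKVmx // => /(congr1 (fun z => alpha y' * z * y')).
  rewrite !clmulE !mulrA -clalphaM y'y clalpha1 mul1r -!mulrA yy' mulr1.
  by move=> ->.
have [a za] : exists a : R, x * y' = a%:A.
  apply: clalpha_central => w; rewrite clalphaM -mulrA y'M mulrA.
  by have := xM (invmx M *m w); rewrite !clmulE mulKVmx // => ->; rewrite -mulrA.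
have : Pin (a%:A : clifford) by rewrite -za; exact: PinM.
have -> : x = a *: y by rewrite -[LHS]mulr1 -y'y mulrA za -scalerAl mul1r.
by move=> /scalar_Pin[]->; rewrite ?scale1r ?scaleN1r; [left|right].
Qed.

Lemma rho_isM (M N : 'M[R]_d) (x y : clifford) :
  rho_is x M -> rho_is y N -> rho_is (x * y : clifford) (M *m N).
Proof.
move=> xM yN w; have := yN w; have := xM (N *m w); rewrite !clmulE clalphaM.
by move=> e1 e2; rewrite -mulrA e2 mulrA e1 -mulrA mulmxA.
Qed.

Lemma rho_is1 : rho_is (1 : clifford) 1%:M.
Proof. by move=> w; rewrite !clmulE clalpha1 mul1mx mul1r mulr1. Qed.

(** * Reflections and orthogonal matrices *)

Definition refl_mx (u : 'cV[R]_d) : 'M[R]_d := 1%:M - 2 *: (u *m u^T).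

Lemma dotcE v w : v^T *m w = (dotc v w)%:M.
Proof.
apply/matrixP => i j; rewrite !ord1 !mxE mulr1n.
by apply: eq_bigr => k _; rewrite mxE.
Qed.

Lemma refl_mxE u w : refl_mx u *m w = w - (2 * dotc u w) *: u.
Proof.
rewrite mulmxBl mul1mx -scalemxAl -mulmxA dotcE mul_mx_scalar scalerA.
by [].
Qed.

(** The Clifford relation gives [- u * w = w * u + 2 * dotc u w], and the last term is
    [- 2 * dotc u w * u * u] because [u * u = -1]. *)
Lemma rho_is_vec u : unit_vec u -> rho_is (clvec u) (refl_mx u).
Proof.
move=> u1 w; rewrite refl_mxE !clmulE clalphaV -scaleNr clvecD clvecZ mulrDl.
rewrite -scalerAl clvec_sqr // mulNr.
have -> : vec u * vec w = (- 2 * dotc u w)%:A - vec w * vec u.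
  by rewrite -clvec_anticomm addrK.
by rewrite opprB scalerN mulNr.
Qed.

Lemma dotcC v w : dotc v w = dotc w v.
Proof. by apply: eq_bigr => i _; rewrite mulrC. Qed.

Lemma dotcBr v w z : dotc v (w - z) = dotc v w - dotc v z.
Proof. by rewrite /dotc -sumrB; apply: eq_bigr => i _; rewrite !mxE mulrBr. Qed.

Lemma dotcZr a v w : dotc v (a *: w) = a * dotc v w.
Proof. by rewrite /dotc mulr_sumr; apply: eq_bigr => i _; rewrite !mxE; ring. Qed.

Lemma dotc_gt0 v : v != 0 -> 0 < dotc v v.
Proof.
move=> v0; rewrite lt0r sumr_ge0 ?andbT => [|i _]; last exact: sqr_ge0.
apply: contraNneq v0 => /psumr_eq0P v0; apply/eqP/matrixP => i j.
rewrite !ord1 mxE; apply/eqP; rewrite -sqrf_eq0 expr2 v0 // => k _.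
exact: sqr_ge0.
Qed.

Lemma orthogonal_dotc (M : 'M[R]_d) v w : orthogonal_mx M ->
  dotc (M *m v) (M *m w) = dotc v w.
Proof.
move=> /mulmx1C oM; have : (dotc (M *m v) (M *m w))%:M = (dotc v w)%:M :> 'M[R]_1.
  by rewrite -!dotcE trmx_mul -mulmxA (mulmxA _ M) oM mul1mx.
by move/(congr1 (fun A : 'M_1 => A 0 0)); rewrite !mxE.
Qed.

Lemma refl_mx_tr u : (refl_mx u)^T = refl_mx u.
Proof. by rewrite linearB linearZ /= trmx1 trmx_mul trmxK. Qed.

Lemma refl_mxK u : unit_vec u -> refl_mx u *m refl_mx u = 1%:M.
Proof.
move=> /unit_vecE u1; rewrite {1}/refl_mx mulmxBl mul1mx -scalemxAl -mulmxA.
have -> : u^T *m refl_mx u = - u^T.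
  rewrite -[LHS]trmxK trmx_mul refl_mx_tr trmxK refl_mxE u1 mulr1.
  by rewrite scaler_nat mulr2n opprD addrA subrr sub0r linearN.
by rewrite mulmxN scalerN opprK /refl_mx subrK.
Qed.

Lemma refl_orthogonal u : unit_vec u -> orthogonal_mx (refl_mx u).
Proof. by move=> u1; rewrite /orthogonal_mx refl_mx_tr refl_mxK. Qed.

Lemma orthogonalM (M N : 'M[R]_d) :
  orthogonal_mx M -> orthogonal_mx N -> orthogonal_mx (M *m N).
Proof.
by move=> oM oN; rewrite /orthogonal_mx trmx_mul -mulmxA (mulmxA N) oN mul1mx.
Qed.

(** As [M *m w] and [w] have equal length, reflecting along their difference maps one to the other;
    vectors fixed by [M] are orthogonal to that difference. The shape of [u] is recorded because for
    an involution [M] it makes [u] a (-1)-eigenvector. *)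
Lemma refl_step (M : 'M[R]_d) w : orthogonal_mx M -> M *m w != w ->
  exists u c, [/\ unit_vec u, u = c *: (M *m w - w),
    refl_mx u *m M *m w = w &
    forall z : 'cV_d, M *m z = z -> refl_mx u *m M *m z = z].
Proof.
move=> oM Mw; pose x := M *m w - w.
have x0 : 0 < dotc x x by apply: dotc_gt0; rewrite subr_eq0.
pose c := (Num.sqrt (dotc x x))^-1.
have c2 : c * c * dotc x x = 1.
  by rewrite -expr2 exprVn sqr_sqrtr ?ltW // mulVf ?gt_eqF.
exists (c *: x), c; split=> //.
- by apply/unit_vecE; rewrite dotcZr dotcC dotcZr mulrA.
- have xx : dotc x x = 2 * dotc x (M *m w).
    have e1 : dotc x x = dotc x (M *m w) - dotc x w by rewrite -dotcBr.
    have e2 : dotc x w = dotc w (M *m w) - dotc w w by rewrite dotcC -dotcBr.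
    have e3 : dotc x (M *m w) = dotc (M *m w) (M *m w) - dotc (M *m w) w.
      by rewrite dotcC -dotcBr.
    by rewrite e1 e3 e2 orthogonal_dotc // (dotcC w); ring.
  rewrite -mulmxA refl_mxE scalerA (_ : _ * _ * c = 1).
    by rewrite scale1r /x subKr.
  by rewrite (dotcC (_ *: _)) dotcZr (dotcC _ x) -[RHS]c2 xx; ring.
move=> z Mz; rewrite -mulmxA refl_mxE (_ : dotc _ _ = 0).
  by rewrite mulr0 scale0r subr0.
have e : dotc z (M *m w) = dotc z w by rewrite -{1}Mz orthogonal_dotc.
by rewrite Mz dotcC dotcZr dotcBr e subrr mulr0.
Qed.

Lemma mx_fix_basis (M : 'M[R]_d) :
  (forall i, M *m delta_mx i 0 = delta_mx i 0 :> 'cV_d) -> M = 1%:M.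
Proof.
move=> Mfix; apply/matrixP => i j.
have /matrixP/(_ i 0) := Mfix j; rewrite !mxE (bigD1 j) //= big1 => [|k kj].
  by rewrite mxE !eqxx mulr1 addr0 andbT.
by rewrite mxE (negPf kj) mulr0.
Qed.

Lemma refl_mul_refl u (M : 'M[R]_d) : unit_vec u -> M = refl_mx u *m (refl_mx u *m M).
Proof. by move=> u1; rewrite mulmxA refl_mxK // mul1mx. Qed.

(* Induction along the flag spanned by the last basis vectors: a reflection in
   [M e_k - e_k] makes [M] fix one more basis vector. *)
Lemma orthogonal_ind (P : 'M[R]_d -> Prop) : P 1%:M ->
  (forall M u c w, orthogonal_mx M -> unit_vec u -> u = c *: (M *m w - w) ->
     P (refl_mx u *m M) -> P M) ->
  forall M, orthogonal_mx M -> P M.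
Proof.
move=> P1 PS.
(* At [k = d] the condition on [M] is void, at [k = 0] it forces the identity. *)
have step k M : (forall i : 'I_d, (k <= i)%N -> M *m delta_mx i 0 = delta_mx i 0 :> 'cV_d) ->
    orthogonal_mx M -> P M.
  elim: k M => [|k IH] M Mfix oM; first by rewrite (mx_fix_basis (M := M)) // => i; apply: Mfix.
  have [dk|kd] := leqP d k.
    by apply: IH => // i ki; move: (leq_trans dk ki); rewrite leqNgt ltn_ord.
  pose w : 'cV[R]_d := delta_mx (Ordinal kd) 0.
  have ltk (i : 'I_d) : (k <= i)%N -> i = Ordinal kd \/ (k < i)%N.
    by rewrite leq_eqVlt => /orP[/eqP e|]; [left; apply: val_inj | right].
  have [Mw|Mw] := eqVneq (M *m w) w.
    by apply: IH => // i /ltk[->|/Mfix].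
  have [u [c [u1 uE uMw uMz]]] := refl_step oM Mw.
  apply: (PS M u c w) => //; apply: IH.
    by move=> i /ltk[-> //|/Mfix /uMz].
  by apply: orthogonalM => //; exact: refl_orthogonal.
by move=> M; apply: (step d) => i; rewrite leqNgt ltn_ord.
Qed.

Lemma Pin_surj (M : 'M[R]_d) : orthogonal_mx M ->
  exists2 x : clifford, Pin x & rho_is x M.
Proof.
move: M; apply: orthogonal_ind => [|M u c w oM u1 _ [x Px xM]].
  by exists 1; [exact: Pin1|exact: rho_is1].
exists (vec u * x); first by apply: PinM => //; exact: Pin_vec.
by rewrite (refl_mul_refl M u1); apply: rho_isM => //; exact: rho_is_vec.
Qed.

(* In the inductive step [refl_mx u *m M] fixes [u], so that
   [alpha x' * u = u * x'], which gives the sign of [(u * x')^2]. *)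
Lemma Pin_involution (M : 'M[R]_d) : orthogonal_mx M -> M *m M = 1%:M ->
  exists x : clifford, exists h : nat,
    [/\ Pin x, rho_is x M, \tr M = d%:R - 2 * h%:R, alpha x = (-1) ^+ h * x
      & x * x = (-1) ^+ 'C(h.+1, 2)].
Proof.
move: M; apply: orthogonal_ind => [_|M u c w oM u1 uE IH MM].
  exists 1, 0%N; split; rewrite ?mulr1 ?clalpha1 ?bin_small //; first exact: Pin1.
    exact: rho_is1.
  by rewrite mxtrace1 mulr0 subr0.
have MT : M^T = M by rewrite -[LHS]mul1mx -MM -mulmxA oM mulmx1.
have Mu : M *m u = - u.
  by rewrite uE -scalemxAr mulmxBr mulmxA MM mul1mx -scalerN opprB.
have uM : u^T *m M = - u^T by rewrite -{1}MT -trmx_mul Mu linearN.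
have rM : refl_mx u *m M = M + 2 *: (u *m u^T).
  by rewrite mulmxBl mul1mx -scalemxAl -mulmxA uM mulmxN scalerN opprK.
have Mr : M *m refl_mx u = M + 2 *: (u *m u^T).
  by rewrite mulmxBr mulmx1 -scalemxAr mulmxA Mu mulNmx scalerN opprK.
(* [M] is symmetric, so [u] is also a left eigenvector and the reflection commutes with [M]; the
   product is again an involution. *)
have MM' : refl_mx u *m M *m (refl_mx u *m M) = 1%:M.
  by rewrite -mulmxA (mulmxA M) Mr -rM !mulmxA refl_mxK // mul1mx.
have [x [h [Px xM trM ax xx]]] := IH MM'.
have uu : dotc u u = 1 by apply/unit_vecE.
exists (vec u * x), h.+1; split.
- by apply: PinM => //; exact: Pin_vec.
- by rewrite (refl_mul_refl M u1); apply: rho_isM => //; exact: rho_is_vec.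
- have -> : M = refl_mx u *m M - 2 *: (u *m u^T) by rewrite rM addrK.
  rewrite linearB linearZ /= trM mxtrace_mulC dotcE uu mxtrace1 -natr1. ring.
- by rewrite clalphaM ax clalphaV exprS mulN1r !mulNr !mulrA (commr_sign (vec u)).
have ux : vec u * x = (-1) ^+ h * x * vec u.
  have := xM u; rewrite !clmulE ax => ->; congr (vec _ * _).
  by rewrite -mulmxA Mu mulmxN refl_mxE uu mulr1 scaler_nat mulr2n opprB addrK.
(* The square is [(-1)^h * x * u * u * x = (-1)^(h+1) * x * x], and ['C(h.+2, 2)] exceeds
   ['C(h.+1, 2)] by [h.+1]. *)
rewrite {1}ux -!mulrA (mulrA (vec u)) clvec_sqr // mulN1r mulrN xx.
by rewrite (binS h.+1 1) bin1 exprD exprS mulN1r !mulrN commr_sign.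
Qed.

End CliffordRing.

(** * Lifts to an extension by signs *)

(* [L g x] is to be read "[x] is a lift of [g]", in a central extension of [G]
   by a subgroup of the sign group. *)
Section SignLifts.
Variables (A : nzRingType) (gT : finGroupType) (G : {group gT}).
Variable L : gT -> A -> Prop.
Hypothesis L_mul : forall g h x y, g \in G -> h \in G ->
  L g x -> L h y -> L (g * h)%g (x * y).
Hypothesis L_sign : forall g x y, g \in G -> L g x -> L g y -> x = y \/ x = - y.
Hypothesis L_one : L 1%g 1.
Hypothesis neq_opp1 : 1 <> - 1 :> A.

Definition lift_on (H : {set gT}) (f : gT -> A) :=
  (forall g, g \in H -> L g (f g)) /\
  {in H &, forall g h, f (g * h)%g = f g * f h}.

Lemma L_exp g x n : g \in G -> L g x -> L (g ^+ n)%g (x ^+ n).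
Proof.
move=> gG gx; elim: n => [|n IH]; first by rewrite expr0 expg0.
by rewrite expgS exprS; apply: L_mul => //; exact: groupX.
Qed.

Lemma L_exp1 g x n : g \in G -> L g x -> (g ^+ n = 1)%g -> x ^+ n = 1 \/ x ^+ n = -1.
Proof. by move=> gG gx gn; apply: (L_sign (group1 G)) => //; rewrite -gn; exact: L_exp. Qed.

(** The only other lift is [- x], whose odd powers are opposite to those of [x]. *)
Lemma L_odd g x y n : odd n -> g \in G -> L g x -> L g y -> x ^+ n = 1 -> y ^+ n = 1 -> x = y.
Proof.
move=> on gG gx gy; have [//|->] := L_sign gG gx gy.
by rewrite exprNn -signr_odd on mulN1r => h1 h2; case: neq_opp1; rewrite -{1}h1 h2.
Qed.

(** The cube of [x] is a sign, so [x ^+ 4] is [x] or [- x]: the fourth power normalises a lift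
    without a choice of sign. *)
Lemma L_cube g x : g \in G -> L g x -> (g ^+ 3 = 1)%g -> L g (x ^+ 4) /\ (x ^+ 4) ^+ 3 = 1.
Proof.
move=> gG gx g3; split; first by rewrite -[g]mulg1 -g3 -expgS; exact: L_exp.
by rewrite -exprM mulnC exprM; have [->|->] := L_exp1 gG gx g3; rewrite ?expr1n // -signr_odd.
Qed.

Section LiftOn.
Variables (H : {group gT}) (f : gT -> A).
Hypothesis fH : lift_on H f.

Lemma lift_on1 : f 1%g = 1.
Proof.
have := fH.2 1%g 1%g (group1 _) (group1 _); rewrite mulg1.
have := L_sign (group1 G) (fH.1 _ (group1 _)) L_one.
by move=> [->|->] //; rewrite mulrNN mulr1 => e; case: neq_opp1.
Qed.

Lemma lift_onX g n : g \in H -> f (g ^+ n)%g = f g ^+ n.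
Proof.
move=> gH; elim: n => [|n IH]; first by rewrite expg0 lift_on1.
by rewrite expgS exprS fH.2 ?groupX // IH.
Qed.

Lemma lift_onV g : g \in H -> f g * f g^-1%g = 1.
Proof. by move=> gH; rewrite -fH.2 ?groupV // mulgV lift_on1. Qed.

Lemma lift_onVl g : g \in H -> f g^-1%g * f g = 1.
Proof. by move=> gH; rewrite -fH.2 ?groupV // mulVg lift_on1. Qed.
End LiftOn.

(** Serves to compare [f] with its conjugate by [y]: where lifts are unique, the two agree. *)
Lemma lift_on_conj (H : {group gT}) f t y : H \subset G -> lift_on H f ->
  t \in G -> L t y -> y * y = 1 -> (t * t = 1)%g ->
  {in H, forall g, t * g * t \in H}%g ->
  lift_on H (fun g => y * f (t * g * t)%g * y).
Proof.
move=> HG fH tG ty yy tt tH; have sG := subsetP HG; split=> [g gH|g h gH hH].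
  have {1}-> : g = (t * (t * g * t) * t)%g by rewrite !mulgA tt mul1g -mulgA tt mulg1.
  have tgt := tH g gH.
  apply: L_mul => //; first by apply: groupM => //; exact: sG.
  by apply: L_mul => //; [exact: sG|exact: fH.1].
have -> : (t * (g * h) * t = (t * g * t) * (t * h * t))%g.
  by rewrite !mulgA -(mulgA _ t t) tt mulg1.
rewrite fH.2 ?tH // !mulrA; congr (_ * _ * _).
by rewrite -mulrA yy mulr1.
Qed.

(** The products [f h] and [f a * y * f b] form a set closed under multiplication by the last
    hypothesis. Only 1 lies in it over the identity, because [t] is outside [H], so this set is the
    graph [D] of a homomorphism. *)
Lemma lift_on_amalgam (H K : {group gT}) f t y : K \subset G ->
  H \subset K -> t \in K -> t \notin H ->
  {in K, forall g, g \in H \/ exists a b, [/\ a \in H, b \in H & (g = a * t * b)%g]} ->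
  lift_on H f -> L t y ->
  {in H, forall h,
     (t * h * t)%g \in H /\ y * f h * y = f (t * h * t)%g \/
     exists a b, [/\ a \in H, b \in H, (t * h * t = a * t * b)%g &
                     y * f h * y = f a * y * f b]} ->
  exists f', lift_on K f'.
Proof.
move=> KG HK tK tH Kdec fH ty Hy.
have sH := subsetP HK; have sG := subsetP KG.
pose D x g := (g \in H /\ x = f g) \/
  exists a b, [/\ a \in H, b \in H, (g = a * t * b)%g & x = f a * y * f b].
have fD a x g : a \in H -> D x g -> D (f a * x) (a * g)%g.
  move=> aH [[gH ->]|[b [c [bH cH -> ->]]]].
    by left; rewrite groupM ?fH.2.
  by right; exists (a * b)%g, c; rewrite groupM ?fH.2 // !mulrA !mulgA.
have Df a x g : a \in H -> D x g -> D (x * f a) (g * a)%g.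
  move=> aH [[gH ->]|[b [c [bH cH -> ->]]]].
    by left; rewrite groupM ?fH.2.
  by right; exists b, (c * a)%g; rewrite groupM ?fH.2 // !mulrA !mulgA.
have DL x g : D x g -> L g x.
  move=> [[gH ->]|[b [c [bH cH -> ->]]]]; first exact: fH.1.
  have [bG cG tG] : [/\ b \in G, c \in G & t \in G].
    by split; apply: sG => //; exact: sH.
  apply: L_mul => //; [exact: groupM| |exact: fH.1].
  by apply: L_mul => //; exact: fH.1.
have DM x x' g g' : D x g -> D x' g' -> D (x * x') (g * g')%g.
  move=> [[gH ->] Dx'|[a [b [aH bH -> ->]]] [[gH ->]|[c [e [cH eH -> ->]]]]].
  - exact: fD.
  - by apply: Df => //; right; exists a, b.
  have -> : (a * t * b * (c * t * e) = a * (t * (b * c) * t) * e)%g by rewrite !mulgA.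
  have -> : f a * y * f b * (f c * y * f e) = f a * (y * f (b * c)%g * y) * f e.
    by rewrite fH.2 // !mulrA.
  by apply: Df => //; apply: fD => //; apply: Hy; exact: groupM.
have fNE g : g \in K -> exists x, D x g.
  move=> /Kdec[gH|[a [b [aH bH ->]]]]; first by exists (f g); left.
  by exists (f a * y * f b); right; exists a, b.
have DX x g n : D x g -> D (x ^+ n) (g ^+ n)%g.
  move=> Dxg; elim: n => [|n IH]; last by rewrite exprS expgS; exact: DM.
  by left; rewrite expr0 expg0 group1 (lift_on1 fH).
have D1 x : D x 1%g -> x = 1.
  move=> [[_ ->]|[a [b [aH bH e _]]]]; first exact: lift_on1 fH.
  case/negP: tH; rewrite (_ : t = a^-1 * b^-1)%g ?groupM ?groupV //.
  by rewrite -[X in (X * _)%g]mulg1 e !mulgA mulVg mul1g mulgK.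
(* The power [z] lies over the inverse of [g], so both [x * z] and [z * x'] lie over the
   identity. *)
have Dfun x x' g : D x g -> D x' g -> x = x'.
  move=> Dx Dx'; have := DX _ _ #[g]%g.-1 Dx'; set z := x' ^+ _ => Dz.
  have gz : (g * g ^+ #[g].-1 = 1)%g by rewrite -expgS prednK ?order_gt0 // expg_order.
  have xz : x * z = 1 by apply: D1; rewrite -gz; exact: DM.
  have zx' : z * x' = 1.
    by rewrite -exprSr exprS; apply: D1; rewrite -gz; exact: DM.
  by rewrite -[x]mulr1 -zx' mulrA xz mul1r.
have [|f' f'P] := @choice _ _ (fun g x => g \in K -> D x g).
  move=> g; case: (boolP (g \in K)) => [/fNE[x]|_]; first by exists x.
  by exists 0.
exists f'; split=> [g /f'P /DL //|g h gK hK]; apply: (Dfun _ _ (g * h)%g).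
  by apply: f'P; exact: groupM.
by apply: DM; exact: f'P.
Qed.
End SignLifts.

(** * The chain of alternating groups *)

Section AltTower.
Local Open Scope group_scope.

(** With [a], [b] the two transpositions, [a * b * a] and [b * a * b] are both [tperm x z], and the
    cube is their product. *)
Lemma tperm_mul_cube (T : finType) (x y z : T) : x != y -> y != z -> x != z ->
  (tperm x y * tperm y z) ^+ 3 = 1.
Proof.
move=> xy yz xz; pose a := tperm x y; pose b := tperm y z.
have aba : a * b * a = tperm x z.
  by have := tpermJ y z a; rewrite /conjg tpermV -mulgA => ->; rewrite tpermR tpermD.
have bab : b * a * b = tperm x z.
  have := tpermJ x y b; rewrite /conjg tpermV -mulgA => ->.
  by rewrite tpermL tpermD // eq_sym.
by rewrite -[RHS](tperm2 x z) -{1}aba -bab !expgS expg0 mulg1 !mulgA.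
Qed.

Variable m : nat.
Local Notation gT := {perm 'I_m.+1}.
(** Having [m.+1] points keeps the type inhabited, so that naturals can name points; the naming is
    faithful only for [i <= m]. *)
Definition pt (i : nat) : 'I_m.+1 := inord i.

(** The group [A_k] on the first [k] points, kept inside the permutations of all points so that the
    tower consists of subgroups of one group. *)
Definition altH k : {set gT} :=
  [set g in 'Alt_('I_m.+1) | [forall i : 'I_m.+1, (k <= i)%N ==> (g i == i)]].

Lemma altHP k (g : gT) :
  reflect (~~ odd_perm g /\ forall i : 'I_m.+1, (k <= i)%N -> g i = i) (g \in altH k).
Proof.
rewrite inE Alt_even; apply: (iffP andP) => [[-> /forallP gi]|[-> gi]]; split=> //.
  by move=> i ki; apply/eqP; exact: (implyP (gi i)).
by apply/forallP => i; apply/implyP => /gi ->.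
Qed.

Lemma altH_group_set k : group_set (altH k).
Proof.
apply/group_setP; split=> [|g h /altHP[eg gi] /altHP[eh hi]].
  by apply/altHP; rewrite odd_perm1; split=> // i _; rewrite perm1.
apply/altHP; rewrite odd_permM (negPf eg); split=> // i ki.
by rewrite permM gi // hi.
Qed.

Canonical altH_group k := Group (altH_group_set k).

Lemma altH_sub k : altH k \subset 'Alt_('I_m.+1).
Proof. by apply/subsetP => g; rewrite inE => /andP[]. Qed.

Lemma altHS k l : (k <= l)%N -> altH k \subset altH l.
Proof.
move=> kl; apply/subsetP => g /altHP[eg gi]; apply/altHP; split=> // i li.
by apply: gi; exact: leq_trans li.
Qed.

Lemma altH_full : altH m.+1 = 'Alt_('I_m.+1).
Proof.
apply/eqP; rewrite eqEsubset altH_sub; apply/subsetP => g; rewrite Alt_even => eg.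
by apply/altHP; split=> // i; rewrite leqNgt ltn_ord.
Qed.

Lemma altH_tperm2 k (x y z w : 'I_m.+1) : (x < k)%N -> (y < k)%N -> (z < k)%N ->
  (w < k)%N -> x != y -> z != w -> tperm x y * tperm z w \in altH k.
Proof.
move=> xk yk zk wk xy zw; apply/altHP; split.
  by rewrite odd_permM !odd_tperm xy zw.
have tD (u v i : 'I_m.+1) : (u < k)%N -> (v < k)%N -> (k <= i)%N -> tperm u v i = i.
  by move=> uk vk ki; rewrite tpermD // -(inj_eq val_inj) /=; lia.
by move=> i ki; rewrite permM !tD.
Qed.

Lemma val_pt i : (i <= m)%N -> pt i = i :> nat.
Proof. exact: inordK. Qed.

Lemma pt_neq i j : (i <= m)%N -> (j <= m)%N -> (i != j)%N -> pt i != pt j.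
Proof. by move=> im jm ij; rewrite -(inj_eq val_inj) /= !val_pt. Qed.

Lemma altH2 (g : gT) : (1 <= m)%N -> g \in altH 2 -> g = 1.
Proof.
move=> m1 /altHP[eg gi]; have p01 : pt 0 != pt 1 by rewrite pt_neq.
have ptE (i : 'I_m.+1) : (i < 2)%N -> i = pt 0 \/ i = pt 1.
  move=> i2; have : (nat_of_ord i == 0)%N || (nat_of_ord i == 1)%N by lia.
  by case/orP => /eqP ii; [left|right]; apply: val_inj; rewrite /= val_pt.
have glt (i : 'I_m.+1) : (i < 2)%N -> (g i < 2)%N.
  move=> i2; rewrite ltnNge; apply/negP => gi2.
  by have /perm_inj e := gi _ gi2; rewrite e leqNgt i2 in gi2.
have lt1 : (pt 1 < 2)%N by rewrite val_pt.
have [g0|g0] : g (pt 0) = pt 0 \/ g (pt 0) = pt 1 by apply: ptE; apply: glt; rewrite val_pt.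
  have g1 : g (pt 1) = pt 1.
    have [e|//] := ptE _ (glt _ lt1).
    by move: p01; rewrite -(inj_eq (@perm_inj _ g)) g0 e eqxx.
  apply/permP => i; rewrite perm1; case: (ltnP i 2) => [|/gi//].
  by move/ptE => [->|->].
have g1 : g (pt 1) = pt 0.
  have [//|e] := ptE _ (glt _ lt1).
  by move: p01; rewrite -(inj_eq (@perm_inj _ g)) g0 e eqxx.
have gE : g = tperm (pt 0) (pt 1).
  apply/permP => i; case: (ltnP i 2) => [/ptE[->|->]|i2].
  - by rewrite tpermL.
  - by rewrite tpermR.
  by rewrite gi // tpermD // -(inj_eq val_inj) /= val_pt //; lia.
by move: eg; rewrite gE odd_tperm p01.
Qed.

Definition cyc3 : gT := tperm (pt 0) (pt 1) * tperm (pt 1) (pt 2).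

Lemma cyc3_altH : (2 <= m)%N -> cyc3 \in altH 3.
Proof. by move=> m2; apply: altH_tperm2; rewrite ?pt_neq ?val_pt //; lia. Qed.

(** The image of the point 2 decides: multiplying by a suitable power of [cyc3] makes [g] fix 2,
    hence lie in the trivial group [altH 2]. *)
Lemma altH3 (g : gT) : (2 <= m)%N -> g \in altH 3 -> [\/ g = 1, g = cyc3 | g = cyc3^-1].
Proof.
move=> m2 gH; have /altHP[eg gi] := gH; have cH := cyc3_altH m2.
have fix2 h : h \in altH 3 -> h (pt 2) = pt 2 -> h = 1.
  move=> /altHP[eh hi] h2; apply: altH2; first lia.
  apply/altHP; split=> // i; rewrite leq_eqVlt => /orP[/eqP i2|/hi//].
  by rewrite (_ : i = pt 2) //; apply: val_inj; rewrite /= val_pt.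
have c2 : cyc3 (pt 2) = pt 1.
  by rewrite permM (tpermD (z := pt 2)) ?pt_neq ?tpermR //; lia.
have c0 : cyc3 (pt 0) = pt 2 by rewrite permM tpermL tpermL.
have [g2|g2|g2] : [\/ g (pt 2) = pt 2, g (pt 2) = pt 1 | g (pt 2) = pt 0].
- have : (g (pt 2) < 3)%N.
    rewrite ltnNge; apply/negP => gi2.
    have /perm_inj e := gi _ gi2; rewrite e val_pt // in gi2.
  move: (g (pt 2)) => j j3.
  have : [|| (nat_of_ord j == 2)%N, (nat_of_ord j == 1)%N | (nat_of_ord j == 0)%N] by lia.
  by case/or3P => /eqP jj; [apply: Or31|apply: Or32|apply: Or33];
    apply: val_inj; rewrite /= val_pt //; lia.
- by apply: Or31; exact: fix2.
- apply: Or32; apply/eqP; rewrite eq_mulgV1; apply/eqP/fix2.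
    by rewrite groupM ?groupV.
  by rewrite permM g2 -c2 permK.
apply: Or33; apply/eqP; rewrite eq_mulgV1 invgK; apply/eqP/fix2.
  by rewrite groupM.
by rewrite permM g2.
Qed.

(* [dbl k] is [t_(k+4)], with the points numbered from 0. *)
Definition dbl k : gT := tperm (pt 0) (pt 1) * tperm (pt k.+2) (pt k.+3).

Lemma dbl_altH k : (k.+3 <= m)%N -> dbl k \in altH k.+4.
Proof. by move=> km; apply: altH_tperm2; rewrite ?pt_neq ?val_pt //; lia. Qed.

Lemma dbl_fix k (i : 'I_m.+1) : (k.+3 <= m)%N -> (k.+4 <= i)%N -> dbl k i = i.
Proof. by move=> km; have /altHP[_] := dbl_altH km; apply. Qed.

Lemma dblE2 k : (k.+3 <= m)%N -> dbl k (pt k.+2) = pt k.+3.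
Proof. by move=> km; rewrite permM (tpermD (x := pt 0)) ?pt_neq ?tpermL //; lia. Qed.

Lemma dblE3 k : (k.+3 <= m)%N -> dbl k (pt k.+3) = pt k.+2.
Proof. by move=> km; rewrite permM (tpermD (x := pt 0)) ?pt_neq ?tpermR //; lia. Qed.

Lemma dbl_notin k : (k.+3 <= m)%N -> dbl k \notin altH k.+3.
Proof.
move=> km; apply/negP => /altHP[_ /(_ (pt k.+3))].
rewrite dblE3 // val_pt // leqnn => /(_ isT)/eqP; apply/negP.
by rewrite pt_neq //; lia.
Qed.

Lemma tperm_comm (x y z w : 'I_m.+1) : x != z -> x != w -> y != z -> y != w ->
  commute (tperm x y) (tperm z w).
Proof.
move=> xz xw yz yw; apply/commgP/conjg_fixP.
by rewrite tpermJ !tpermD // eq_sym.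
Qed.

Lemma dbl_sqr k : (k.+3 <= m)%N -> dbl k * dbl k = 1.
Proof.
move=> km; rewrite {1}/dbl (tperm_comm (x := pt 0)) ?pt_neq //; try lia.
by rewrite /dbl -mulgA (mulgA (tperm (pt 0) _)) tperm2 mul1g tperm2.
Qed.

(** The common factor [(0 1)] cancels, here and in [dbl_dbl_cube], leaving two transpositions that
    share one point. *)
Lemma dbl_cyc3_cube : (3 <= m)%N -> (dbl 0 * cyc3) ^+ 3 = 1.
Proof.
move=> m3; rewrite /dbl /cyc3 (tperm_comm (x := pt 0)) ?pt_neq //; try lia.
rewrite -mulgA (mulgA (tperm (pt 0) _)) tperm2 mul1g.
by rewrite (tpermC (pt 2)) (tpermC (pt 1)) tperm_mul_cube ?pt_neq //; lia.
Qed.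

Lemma dbl_dbl_cube k : (k.+4 <= m)%N -> (dbl k.+1 * dbl k) ^+ 3 = 1.
Proof.
move=> km; rewrite /dbl (tperm_comm (x := pt 0) (z := pt k.+3)) ?pt_neq //; try lia.
rewrite -mulgA (mulgA (tperm (pt 0) _)) tperm2 mul1g.
by rewrite (tpermC (pt k.+3)) (tpermC (pt k.+2)) tperm_mul_cube ?pt_neq //; lia.
Qed.

(** [dbl k.+1] swaps [k.+3] and [k.+4] and fixes all later points, so it preserves the set of points
    from [k.+3] on, which [altH k.+3] fixes pointwise. *)
Lemma dbl_norm k : (k.+4 <= m)%N ->
  {in altH k.+3, forall g, dbl k.+1 * g * dbl k.+1 \in altH k.+3}.
Proof.
move=> km g /altHP[eg gi]; have /altHP[et _] := dbl_altH km; apply/altHP; split.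
  by rewrite odd_permM (negPf et) addbF odd_permM (negPf et).
move=> i ki; rewrite (permM (_ * g)) (permM _ g) gi; first by rewrite -permM dbl_sqr ?perm1.
case: (ltnP i k.+4.+1) => [i5|i5]; last by rewrite dbl_fix.
have : (nat_of_ord i == k.+3)%N || (nat_of_ord i == k.+4)%N by lia.
case/orP => /eqP ii.
  by rewrite (_ : i = pt k.+3) ?dblE2 ?val_pt //; apply: val_inj; rewrite /= val_pt //; lia.
by rewrite (_ : i = pt k.+4) ?dblE3 ?val_pt //; try apply: val_inj; rewrite /= ?val_pt //; lia.
Qed.

(** If [g] moves the last point [k.+3], let [a] carry the preimage of that point to [k.+2]; then
    [dbl k * a^-1 * g] fixes [k.+3] and serves as [b]. *)
Lemma altH_dec k : (k.+3 <= m)%N -> {in altH k.+4, forall g, g \in altH k.+3 \/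
  exists a b, [/\ a \in altH k.+3, b \in altH k.+3 & g = a * dbl k * b]}.
Proof.
move=> km g gH; have /altHP[eg gi] := gH.
have ltk (i : 'I_m.+1) : (k.+3 <= i)%N -> i = pt k.+3 \/ (k.+4 <= i)%N.
  rewrite leq_eqVlt => /orP[/eqP e|]; [left; apply: val_inj | by right].
  by rewrite /= val_pt.
have [g3|g3] := eqVneq (g (pt k.+3)) (pt k.+3).
  by left; apply/altHP; split=> // i /ltk[->|/gi].
right; pose i0 := g^-1 (pt k.+3).
have gi0 : g i0 = pt k.+3 by rewrite permKV.
have i03 : (i0 < k.+3)%N.
  rewrite ltnNge; apply/negP => /ltk[e|/gi e]; first by rewrite -e gi0 e eqxx in g3.
  by move: g3; rewrite (_ : pt _ = i0) ?e ?eqxx // -gi0.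
have [a aH ai0] : exists2 a, a \in altH k.+3 & a i0 = pt k.+2.
  have [->|i02] := eqVneq i0 (pt k.+2); first by exists 1; rewrite ?group1 ?perm1.
  have [j [j3 ji j2]] : exists j : 'I_m.+1, [/\ (j < k.+3)%N, i0 != j & pt k.+2 != j].
    have [->|i00] := eqVneq i0 (pt 0).
      by exists (pt 1); rewrite val_pt ?pt_neq //; lia.
    by exists (pt 0); rewrite val_pt // pt_neq //; lia.
  (* The second transposition makes [a] even and leaves [k.+2] in place. *)
  exists (tperm i0 (pt k.+2) * tperm i0 j); last by rewrite permM tpermL tpermD // eq_sym.
  by apply: altH_tperm2; rewrite // val_pt //; lia.
exists a, (dbl k * a^-1 * g); split=> //; last first.
  have := dbl_sqr km; move: (dbl k) => t tt.
  by rewrite !mulgA -(mulgA a) tt mulg1 mulgV mul1g.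
have /altHP[ea ai] := aH; have /altHP[et _] := dbl_altH km.
apply/altHP; split; first by rewrite odd_permM odd_permM odd_permV (negPf ea) (negPf eg) (negPf et).
move=> i /ltk[->|ki]; rewrite (permM (_ * a^-1)) (permM _ a^-1).
  by rewrite dblE3 // -ai0 permK.
rewrite dbl_fix // -{1}(ai i) ?permK ?gi //; exact: ltnW.
Qed.

End AltTower.

(** * Relations from products of order 3 *)

Section InvolutionCube.
Local Open Scope group_scope.
Variables (gT : finGroupType) (a b : gT).

(** When [a * b] has cube 1 its square is its inverse, and [a] appears as a conjugate of [b]; with
    powers only, the formula carries over to lifts in a ring. *)
Lemma cube_conj : a * a = 1 -> b * b = 1 ->
  a = (a * b) ^+ 2 * b * (a * b).
Proof.
move=> aa bb; rewrite expgS expg1 -(mulgA (a * b) _ b) -(mulgA a b b) bb mulg1.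
by rewrite -(mulgA (a * b) a) (mulgA a a) aa mul1g -mulgA bb mulg1.
Qed.

(** The inverses on the right are there because at the bottom of the tower [b] is a 3-cycle.
    [mul_braid] is the counterpart for lifts. *)
Lemma cube_braid : a * a = 1 -> (a * b) ^+ 3 = 1 -> a * b * a = b^-1 * a * b^-1.
Proof.
move=> aa ab3; have aV : a^-1 = a by apply: (mulgI a); rewrite mulgV aa.
apply/eqP; rewrite eq_mulgV1 !invMg !invgK aV; apply/eqP.
by rewrite -ab3 !expgS expg0 mulg1 !mulgA.
Qed.
End InvolutionCube.

Lemma mul_braid (A : nzRingType) (y c c' : A) : y * y = 1 -> c * c' = 1 ->
  (y * c) ^+ 3 = 1 -> y * c * y = c' * y * c'.
Proof.
move=> yy cc'; rewrite !exprS expr0 mulr1 !mulrA => yc3.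
have e : y * c * y * c * y = c' by rewrite -[RHS]mul1r -yc3 -[RHS]mulrA cc' mulr1.
by rewrite -{1}e -[RHS]mulrA -(mulrA _ y) (mulrA y y) yy mul1r -!mulrA cc' mulr1.
Qed.

(** * Lifts over the tower of alternating groups *)

Section AltLifts.
Variables (A : nzRingType) (m : nat).
Local Notation gT := {perm 'I_m.+1}.
Local Notation G := ('Alt_('I_m.+1))%G.
Variable L : gT -> A -> Prop.
Hypothesis L_ex : forall g, g \in G -> exists x, L g x.
Hypothesis L_mul : forall g h x y, g \in G -> h \in G ->
  L g x -> L h y -> L (g * h)%g (x * y).
Hypothesis L_sign : forall g x y, g \in G -> L g x -> L g y -> x = y \/ x = - y.
Hypothesis L_one : L 1%g 1.
Hypothesis neq_opp1 : 1 <> - 1 :> A.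
Local Notation lift_on := (lift_on L).
Local Notation H k := (altH_group m k).
Local Notation t := (dbl m).

Let HG k g : g \in H k -> g \in G.
Proof. exact: (subsetP (altH_sub m k)). Qed.

Let tG k : (k.+3 <= m)%N -> t k \in G.
Proof. by move=> km; apply: (@HG k.+4); exact: dbl_altH. Qed.

Lemma cyc3X3 : (2 <= m)%N -> (cyc3 m ^+ 3 = 1)%g.
Proof. by move=> m2; rewrite tperm_mul_cube ?pt_neq //; lia. Qed.

Lemma altH3_cube g : (2 <= m)%N -> g \in H 3 -> (g ^+ 3 = 1)%g.
Proof.
move=> m2 /(altH3 m2)[]->; rewrite ?expg1n ?expVgn ?cyc3X3 ?invg1 //.
Qed.

Lemma altH3_comm g h : (2 <= m)%N -> g \in H 3 -> h \in H 3 -> (g * h = h * g)%g.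
Proof.
by move=> m2 /(altH3 m2)[]-> /(altH3 m2)[]->; rewrite ?mulg1 ?mul1g ?mulgV ?mulVg.
Qed.

(** Choosing the lifts of cube 1 is multiplicative: lifts of commuting elements commute up to sign,
    cube 1 excludes the minus sign, and then a product of such lifts has cube 1 again. *)
Lemma altH3_lift : (2 <= m)%N -> exists f, lift_on (H 3) f.
Proof.
move=> m2; have [|l lP] := @choice _ _ (fun g x => g \in G -> L g x).
  move=> g; case: (boolP (g \in G)) => [/L_ex[x]|_]; first by exists x.
  by exists 0.
have cube g (gH : g \in H 3) := L_cube L_mul L_sign L_one (HG gH) (lP g (HG gH)) (altH3_cube m2 gH).
exists (fun g => l g ^+ 4); split=> [g /cube[]//|g h gH hH].
have [Lg g3] := cube g gH; have [Lh h3] := cube h hH.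
have [Lgh gh3] := cube _ (groupM gH hH).
have gG := HG gH; have hG := HG hH.
have Lhg : L (g * h)%g (l h ^+ 4 * l g ^+ 4) by rewrite altH3_comm //; exact: L_mul.
apply: (L_odd L_sign neq_opp1 (n := 3) (g := (g * h)%g)) => //.
- exact: groupM.
- exact: L_mul.
move: (l g ^+ 4) (l h ^+ 4) Lg Lh g3 h3 Lhg => x y Lg Lh x3 y3 Lhg.
have [xy|xy] : x * y = y * x \/ x * y = - (y * x).
- by apply: (L_sign (g := (g * h)%g)) => //; [exact: groupM|exact: L_mul].
- by rewrite exprMn_comm // x3 y3 mulr1.
(* Moving [x] past [y] three times changes the sign, while [y ^+ 3 = 1]. *)
have xN : x = - x.
  have xyy : x * y * y = y * y * x by rewrite xy mulNr -(mulrA y x y) xy mulrN opprK mulrA.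
  have y3E : y * y * y = 1 by rewrite -y3 !exprS expr0 mulr1 mulrA.
  rewrite -{1}[x]mulr1 -{2}[x]mul1r -y3E !mulrA xyy.
  by rewrite -[LHS]mulrA xy mulrN !mulrA.
by case: neq_opp1; rewrite -{1}x3 -x3 exprS {1}xN mulNr.
Qed.

Let lift1 k f (fH : lift_on (H k) f) := lift_on1 L_sign L_one neq_opp1 fH.
Let liftX k f (fH : lift_on (H k) f) := lift_onX L_sign L_one neq_opp1 fH.
Let liftV k f (fH : lift_on (H k) f) := lift_onV L_sign L_one neq_opp1 fH.
Let liftVl k f (fH : lift_on (H k) f) := lift_onVl L_sign L_one neq_opp1 fH.

(** The element preceding [t k] in the tower, chosen so that [t k * s k] has cube 1. *)
Let s k := if k is k'.+1 then t k' else cyc3 m.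

Let sH k : (k.+2 <= m)%N -> s k \in H k.+3.
Proof. by case: k => [|k] km; [exact: cyc3_altH|exact: dbl_altH]. Qed.

Let ts_cube k : (k.+3 <= m)%N -> ((t k * s k) ^+ 3 = 1)%g.
Proof. by case: k => [|k] km; [exact: dbl_cyc3_cube|exact: dbl_dbl_cube]. Qed.

Lemma lift_on_sub k l f : (k <= l)%N -> lift_on (H l) f -> lift_on (H k) f.
Proof.
move=> kl [fL fM]; have sub := subsetP (altHS m kl).
by split=> [g /sub|g h /sub ? /sub ?]; [exact: fL|exact: fM].
Qed.

(** Elements of cube 1 have a forced value. This settles [A_3]; further up it fixes the value at
    [t k * s k], hence at [t k], and the double coset decomposition does the rest. *)
Lemma alt_lift_uniq k f f' : (k.+2 <= m)%N -> lift_on (H k.+3) f ->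
  lift_on (H k.+3) f' -> {in H k.+3, f =1 f'}.
Proof.
have cubeE l h f1 f2 : h \in H l -> (h ^+ 3 = 1)%g -> lift_on (H l) f1 ->
    lift_on (H l) f2 -> f1 h = f2 h.
  move=> hH h3 fH1 fH2; apply: (L_odd L_sign neq_opp1 (n := 3) (g := h)) => //.
  - exact: HG hH.
  - exact: fH1.1.
  - exact: fH2.1.
  - by rewrite -(liftX fH1) // h3 (lift1 fH1).
  - by rewrite -(liftX fH2) // h3 (lift1 fH2).
elim: k f f' => [|k IH] f f' km fH fH' g gH.
  exact: (cubeE 3) (altH3_cube km gH) fH fH'.
have fH3 := lift_on_sub (leqnSn k.+3) fH; have fH3' := lift_on_sub (leqnSn k.+3) fH'.
have E := IH f f' (ltnW km) fH3 fH3'.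
have sub := subsetP (altHS m (leqnSn k.+3)).
have tH := dbl_altH km; have sH4 := sub _ (sH (ltnW km)).
have Et : f (t k) = f' (t k).
  have := cubeE _ _ f f' (groupM tH sH4) (ts_cube km) fH fH'.
  rewrite (fH.2 _ _ tH sH4) (fH'.2 _ _ tH sH4) -(E _ (sH (ltnW km))).
  move/(congr1 (fun x => x * f (s k)^-1%g)).
  by rewrite -!mulrA (liftV fH sH4) !mulr1.
have [/E//|[a [b [aH bH ->]]]] := altH_dec km gH.
have [aH4 bH4] := (sub _ aH, sub _ bH).
have atH : (a * t k)%g \in H k.+4 by exact: groupM.
rewrite (fH.2 _ _ atH bH4) (fH'.2 _ _ atH bH4) (fH.2 _ _ aH4 tH) (fH'.2 _ _ aH4 tH).
by rewrite Et (E _ aH) (E _ bH).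
Qed.

(* [dbl k.+1] is the conjugate of [dbl k] by the element [dbl k * dbl k.+1] of
   order 3. *)
Lemma dbl_lift_sqr : (forall y, L (t 0) y -> y * y = 1) ->
  forall k, (k.+3 <= m)%N -> forall y, L (t k) y -> y * y = 1.
Proof.
move=> sqr0; elim=> // k IH km y ty; pose u := (t k.+1 * t k)%g.
have km' := ltnW km; have uG : u \in G by apply: groupM; exact: tG.
have [w uw] := L_ex uG; have u3 := dbl_dbl_cube km.
have [Lz z3] := L_cube L_mul L_sign L_one uG uw u3.
move: (w ^+ 4) Lz z3 => z Lz z3.
have [x tx] := L_ex (tG km').
have xx := IH km' x tx.
have tE : t k.+1 = (u ^+ 2 * t k * u)%g by apply: cube_conj; exact: dbl_sqr.
have tk' := tG km'.
have Ly' : L (t k.+1) (z ^+ 2 * x * z).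
  rewrite tE; apply: L_mul => //; first by rewrite groupM ?groupX.
  by apply: L_mul => //; [exact: groupX|exact: (L_exp L_mul L_one 2 uG Lz)].
have sq : (z ^+ 2 * x * z) * (z ^+ 2 * x * z) = 1.
  have zz2 : z * z ^+ 2 = 1 by rewrite -exprS z3.
  have z2z : z ^+ 2 * z = 1 by rewrite -exprSr z3.
  move: (z ^+ 2) zz2 z2z => z2 zz2 z2z.
  by rewrite -!mulrA (mulrA z z2) zz2 mul1r (mulrA x x) xx mul1r.
by have [->|->] := L_sign (tG km) ty Ly'; rewrite ?mulrNN.
Qed.

(** This is the closure condition of [lift_on_amalgam] for one step of the tower. At the bottom the
    three elements of [A_3] are checked; above, [h] is split once more by [altH_dec]. *)
Lemma alt_lift_closed k y f : (k.+3 <= m)%N -> lift_on (H k.+3) f ->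
  L (t k) y -> y * y = 1 -> (y * f (s k)) ^+ 3 = 1 ->
  {in H k.+3, forall h,
     (t k * h * t k)%g \in H k.+3 /\ y * f h * y = f (t k * h * t k)%g \/
     exists a b, [/\ a \in H k.+3, b \in H k.+3, (t k * h * t k = a * t k * b)%g &
                     y * f h * y = f a * y * f b]}.
Proof.
move=> km fH ty yy ys3; have tt := dbl_sqr km.
have sHk := sH (ltnW km); have sVH : (s k)^-1%g \in H k.+3 by rewrite groupV.
have tst := cube_braid tt (ts_cube km).
have ysy := mul_braid yy (liftV fH sHk) ys3.
case: k km fH ty ys3 tt sHk sVH tst ysy => [|k] km fH ty ys3 tt sHk sVH tst ysy h hH.
  have [hE|hE|hE] := altH3 (ltnW km) hH; subst h.
  - by left; rewrite mulg1 tt (lift1 fH) mulr1.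
  - by right; exists (cyc3 m)^-1%g, (cyc3 m)^-1%g.
  (* For the inverse 3-cycle the braid relation is inverted, first in the group and then for the
     lifts. *)
  right; exists (cyc3 m), (cyc3 m); split=> //.
    move: tst tt; rewrite /s; move: (t 0) (cyc3 m) => u c ucu uu.
    have uV : (u^-1 = u)%g by apply: (mulgI u); rewrite mulgV uu.
    by have := congr1 (fun g => g^-1)%g ucu; rewrite /= !invMg !invgK uV !mulgA.
  move: (liftV fH sHk) (liftVl fH sHk) ysy; rewrite /s /=.
  move: (f (cyc3 m)) (f (cyc3 m)^-1%g) => c c' cc' c'c ycy.
  have e1 : (y * c' * y) * (y * c * y) = 1.
    by rewrite !mulrA -(mulrA _ y y) yy mulr1 -(mulrA y c' c) c'c mulr1.
  have e2 : (c' * y * c') * (c * y * c) = 1.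
    by rewrite !mulrA -(mulrA _ c' c) c'c mulr1 -(mulrA c' y y) yy mulr1.
  by rewrite -[LHS]mulr1 -e2 -ycy !mulrA -(mulrA (y * c') y y) yy mulr1
    -(mulrA y c' c) c'c mulr1 yy mul1r.
have norm := dbl_norm km.
have fH3 := lift_on_sub (leqnSn k.+3) fH; have sub := subsetP (altHS m (leqnSn k.+3)).
(* Conjugation by [y] gives a second lift on [altH k.+3], which uniqueness identifies with [f]. *)
have gH3 : lift_on (H k.+3) (fun g => y * f (t k.+1 * g * t k.+1)%g * y).
  by apply: (lift_on_conj L_mul) => //; [exact: altH_sub|exact: tG].
have conjf g : g \in H k.+3 -> y * f g * y = f (t k.+1 * g * t k.+1)%g.
  move=> gH; rewrite -(alt_lift_uniq (ltnW (ltnW km)) gH3 fH3 (norm g gH)).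
  congr (_ * f _ * _); move: (t k.+1) tt => u uu.
  by rewrite !mulgA uu mul1g -mulgA uu mulg1.
have [hH3|[a [b [aH bH ->]]]] := altH_dec (ltnW km) hH.
  by left; split; [apply/sub/norm|exact: conjf].
right; rewrite /s in sHk sVH tst ysy.
have tk2 : ((t k)^-1 = t k)%g by apply: (mulgI (t k)); rewrite mulgV dbl_sqr // ltnW.
(* In [t k.+1 * a * t k * b * t k.+1] insert [t k.+1 * t k.+1] on both sides of [t k] and apply the
   braid relation [t k.+1 * t k * t k.+1 = t k * t k.+1 * t k]. *)
exists (t k.+1 * a * t k.+1 * t k)%g, (t k * (t k.+1 * b * t k.+1))%g.
have [a'H b'H] := (sub _ (norm a aH), sub _ (norm b bH)).
have atH : (a * t k)%g \in H k.+4 by rewrite groupM ?(sub _ aH).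
split; [by rewrite groupM|by rewrite groupM| |].
  move: tst tt; rewrite tk2; move: (t k) (t k.+1) => u v vuv vv.
  have -> : (v * a * v * u * v * (u * (v * b * v)) = v * a * v * (u * v * u) * (v * b * v))%g.
    by rewrite !mulgA.
  by rewrite -vuv !mulgA -!(mulgA _ v v) vv !mulg1.
rewrite (fH.2 _ _ atH (sub _ bH)) (fH.2 _ _ (sub _ aH) sHk).
rewrite (fH.2 _ _ a'H sHk) (fH.2 _ _ sHk b'H) -!conjf //.
move: ysy; rewrite tk2; move: (f (t k)) (f a) (f b) => u v w yuy.
have -> : y * v * y * u * y * (u * (y * w * y)) = y * v * y * (u * y * u) * (y * w * y).
  by rewrite !mulrA.
by rewrite -yuy !mulrA -!(mulrA _ y y) yy !mulr1.
Qed.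

Lemma alt_lift_exists : (forall y, L (t 0) y -> y * y = 1) ->
  forall k, (k.+2 <= m)%N -> exists f, lift_on (H k.+3) f.
Proof.
move=> sqr0; elim=> [|k IH] km; first exact: altH3_lift.
have km' := ltnW km; have [f fH] := IH km'.
have sHk := sH km'; have tGk := tG km.
have tsG : (t k * s k)%g \in G by rewrite groupM // (HG sHk).
have [w Lw] := L_ex tsG.
have [Lz z3] := L_cube L_mul L_sign L_one tsG Lw (ts_cube km).
move: (w ^+ 4) Lz z3 => z Lz z3.
have sVH : (s k)^-1%g \in H k.+3 by rewrite groupV.
(* Chosen so that [y * f (s k)] is the lift [z] of cube 1. *)
pose y := z * f (s k)^-1%g.
have ys : y * f (s k) = z by rewrite -mulrA (liftVl fH sHk) mulr1.
have ty : L (t k) y.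
  rewrite -[t k](mulgK (s k)); apply: L_mul => //; first by rewrite (HG sVH).
  exact: fH.1.
have yy : y * y = 1 by exact: (dbl_lift_sqr sqr0 km).
apply: (lift_on_amalgam L_mul L_sign L_one neq_opp1 (H := H k.+3) (K := H k.+4) (t := t k)
  _ _ _ _ _ fH ty).
- exact: altH_sub.
- exact: altHS.
- exact: dbl_altH.
- exact: dbl_notin.
- exact: altH_dec.
- by apply: alt_lift_closed => //; rewrite ys.
Qed.

(** The index [m.-2.+3] is [m.+1], put in the form [k.+3] of the induction. *)
Let altH_top : (3 <= m)%N -> altH m m.-2.+3 = ('Alt_('I_m.+1))%g.
Proof. by move=> m3; rewrite -(altH_full m); congr (altH m _); lia. Qed.

Lemma Alt_lift_exists : (3 <= m)%N -> (forall y, L (t 0) y -> y * y = 1) ->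
  exists f, lift_on G f.
Proof.
move=> m3 sqr0; have mE : (m.-2.+2 <= m)%N by lia.
have [f fH] := alt_lift_exists sqr0 mE.
by exists f; rewrite /= -altH_top.
Qed.

Lemma Alt_lift_uniq f f' : (3 <= m)%N -> lift_on G f -> lift_on G f' -> {in G, f =1 f'}.
Proof.
move=> m3; have mE : (m.-2.+2 <= m)%N by lia.
by move: (alt_lift_uniq (f := f) (f' := f') mE); rewrite /= altH_top.
Qed.
End AltLifts.

(** * Signs and parity in the Pin group *)

Section PinLifts.
Variables (R : realType) (d : nat).
Local Notation cl := (clifford R d).
Implicit Types x y z : cl.

Lemma clone_neqN : 1 <> - 1 :> cl.
Proof.
move/ffunP/(_ set0); rewrite !ffunE eqxx => /eqP.
by rewrite -addr_eq0 -mulr2n pnatr_eq0.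
Qed.

Lemma Pin_neqN x : Pin x -> x <> - x.
Proof.
case/Pin_inv => y [_ xy _] xN; apply: clone_neqN.
by rewrite -{1}xy {1}xN mulNr xy.
Qed.

(** [clalpha] negates a product of an odd number of vectors, hence also its cube, but it fixes 1. *)
Lemma Pin_cube_even z : Pin z -> z ^+ 3 = 1 -> clalpha z = z.
Proof.
case/PinP => s s1 -> s3; rewrite clalpha_vecprod -signr_odd.
case: (boolP (odd (size s))) => [os|]; last by rewrite mul1r.
case: clone_neqN; rewrite -{1}(clalpha1 R d) -s3 !exprS expr0 mulr1 !clalphaM.
by rewrite clalpha_vecprod -signr_odd os !mulN1r !mulNr !mulrN opprK.
Qed.

Lemma orthogonal_unit (M : 'M[R]_d) : orthogonal_mx M -> M \in unitmx.
Proof. by case/mulmx1_unit. Qed.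
End PinLifts.

(** * The divisibility criterion and the conclusion *)

Lemma odd_bin2 h : ~~ odd h -> odd 'C(h.+1, 2) = odd h./2.
Proof.
move=> eh; rewrite -[in LHS](even_halfK eh) bin2 /= -doubleMr doubleK oddM /= odd_double.
by [].
Qed.

(** The two parities are the two obstructions: that of [h] decides whether a lift of the involution
    is even, that of the binomial whether it squares to 1. For [h = 2 * q] the binomial is
    [q * (2 * q + 1)], of the parity of [q]. *)
Lemma dvd4_odd h : (4 %| h)%N = ~~ odd h && ~~ odd 'C(h.+1, 2).
Proof.
case: (boolP (odd h)) => [oh|eh] /=; first by lia.
by rewrite odd_bin2 //; lia.
Qed.

Lemma natr_dvd4 (R : realType) h : (exists k : int, h%:R = 4 * k%:~R :> R) <-> (4 %| h)%N.
Proof.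
split=> [[k /eqP]|/dvdnP[k ->]]; last by exists k%:Z; rewrite natrM mulrC.
rewrite -[h%:R]/(h%:Z%:~R) -[4]/(4%:Z%:~R) -intrM eqr_int => /eqP e; lia.
Qed.

Lemma s1s3E m (hn : (3 < m.+1)%N) : s1s3 hn = dbl m 0.
Proof.
rewrite /s1s3 /dbl; congr (tperm _ _ * tperm _ _)%g; apply: val_inj; rewrite /= inordK //; lia.
Qed.

Unset Implicit Arguments.

Theorem theorem4p1 (R : realType) (n : nat) (hn : (3 < n)%N) (d : nat)
    (pi : {perm 'I_n} -> 'M[R]_d) :
  real_orth_rep (('Alt_('I_n))%g) pi ->
  let h := (rep_char pi 1%g - rep_char pi (s1s3 hn)) / 2 in
  (spinorial (('Alt_('I_n))%g) pi <-> exists k : int, h = 4 * k%:~R) /\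
  ((exists k : int, h = 4 * k%:~R) ->
     forall phi1 phi2, is_lift (('Alt_('I_n))%g) pi phi1 -> is_lift (('Alt_('I_n))%g) pi phi2 ->
       forall g, g \in ('Alt_('I_n))%g -> phi1 g = phi2 g).
Proof.
case: n hn pi => // m hn pi [pi1 piM piO] h.
have m3 : (3 <= m)%N by [].
pose L (g : {perm 'I_m.+1}) (x : clifford R d) := Pin x /\ rho_is x (pi g).
have L_ex g : g \in ('Alt_('I_m.+1))%g -> exists x, L g x.
  by move=> /piO /Pin_surj[x Px xg]; exists x.
have L_mul g k x y : g \in ('Alt_('I_m.+1))%g -> k \in ('Alt_('I_m.+1))%g ->
    L g x -> L k y -> L (g * k)%g (x * y).
  move=> gG kG [Px xg] [Py yk]; split; first exact: PinM.
  by rewrite piM //; exact: rho_isM.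
have L_sign g x y : g \in ('Alt_('I_m.+1))%g -> L g x -> L g y -> x = y \/ x = - y.
  move=> gG [Px xg] [Py yg]; apply: (rho_is_uniq (M := pi g)) => //.
  exact/orthogonal_unit/piO.
have L_one : L 1%g 1 by split; [exact: Pin1|rewrite pi1; exact: rho_is1].
have neq1 := @clone_neqN R d.
have liftE phi : is_lift ('Alt_('I_m.+1))%g pi phi <-> lift_on L ('Alt_('I_m.+1))%g phi.
  split=> [[p1 p2 p3]|[p1 p2]].
    by split=> [g gG|g k gG kG]; [split; [exact: p1|exact: p3]|exact: p2].
  by split=> [g gG|g k gG kG|g gG]; [have [] := p1 g gG|exact: p2|have [] := p1 g gG].
have tH := dbl_altH m3; have tG := subsetP (altH_sub _ _) _ tH.
have tt := dbl_sqr m3.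
(* Here [hh] is the dimension of the (-1)-eigenspace, which the trace formula identifies with
   [h]. *)
have [x [hh [Px xt trt ax xx]]] : exists x : clifford R d, exists hh : nat,
    [/\ Pin x, rho_is x (pi (dbl m 0)), \tr (pi (dbl m 0)) = d%:R - 2 * hh%:R,
        clalpha x = (-1) ^+ hh * x & x * x = (-1) ^+ 'C(hh.+1, 2)].
  by apply: Pin_involution; [exact: piO|rewrite -piM // tt].
have hE : h = hh%:R.
  rewrite /h /rep_char s1s3E trt pi1 mxtrace1 opprB addrCA subrr addr0.
  by rewrite mulrAC divff ?mul1r // pnatr_eq0.
have spinP : spinorial ('Alt_('I_m.+1))%g pi <-> (4 %| hh)%N.
  split=> [[phi0 /liftE phi0L]|].
    (* The lift is retyped with values in the ring [clifford]. *)
    have [phi phiL] : exists phi : {perm 'I_m.+1} -> clifford R d,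
      lift_on L ('Alt_('I_m.+1))%g phi by exists phi0.
    have phiX := lift_onX L_sign L_one neq1 phiL (H := ('Alt_('I_m.+1))%G).
    have phi1 := lift_on1 L_sign L_one neq1 phiL.
    rewrite dvd4_odd.
    have cG : cyc3 m \in ('Alt_('I_m.+1))%g.
      by apply: (subsetP (altH_sub m 3)); apply: cyc3_altH; exact: ltnW.
    have cube g : g \in ('Alt_('I_m.+1))%g -> (g ^+ 3 = 1)%g -> clalpha (phi g) = phi g.
      move=> gG g3; apply: Pin_cube_even; first by have [] := phiL.1 g gG.
      by rewrite -phiX // g3.
    have tcG : (dbl m 0 * cyc3 m)%g \in ('Alt_('I_m.+1))%g by rewrite groupM.
    have cVG : (cyc3 m)^-1%g \in ('Alt_('I_m.+1))%g by rewrite groupV.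
    (* [dbl m 0] is a product of two elements of cube 1, whose values are even. *)
    have tE : phi (dbl m 0) = phi (dbl m 0 * cyc3 m)%g * phi (cyc3 m)^-1%g.
      by rewrite -(phiL.2 _ _ tcG cVG) mulgK.
    have phit : clalpha (phi (dbl m 0)) = phi (dbl m 0).
      rewrite tE clalphaM (cube _ tcG (dbl_cyc3_cube m3)) (cube _ cVG) //.
      by rewrite expVgn cyc3X3 ?invg1 // ltnW.
    have [Pt tL] := phiL.1 _ tG.
    have axx : clalpha x = x.
      have [e|e] := L_sign _ _ _ tG (conj Px xt) (conj Pt tL); first by rewrite e.
      by rewrite e clalphaN phit.
    have ptt : phi (dbl m 0) * phi (dbl m 0) = 1 by rewrite -phiL.2 // tt phi1.
    have xx1 : x * x = 1.
      by have [->|->] := L_sign _ _ _ tG (conj Px xt) (conj Pt tL); rewrite ?mulrNN.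
    (* An odd [hh] would give [x = - x], an odd binomial [1 = -1]. *)
    apply/andP; split; apply/negP => o.
      by apply: (Pin_neqN Px); rewrite -{1}axx ax -signr_odd o mulN1r.
    by apply: neq1; rewrite -{1}xx1 xx -signr_odd o.
  rewrite dvd4_odd => /andP[_ eC].
  have sqr1 y : L (dbl m 0) y -> y * y = 1.
    move=> Ly; have [->|->] := L_sign _ _ _ tG Ly (conj Px xt);
      by rewrite ?mulrNN xx -signr_odd (negPf eC).
  have [phi phiL] := Alt_lift_exists L_ex L_mul L_sign L_one neq1 m3 sqr1.
  by exists phi; apply/liftE.
rewrite hE natr_dvd4; split=> // _ phi1 phi2 /liftE l1 /liftE l2 g gG.
exact: (Alt_lift_uniq L_sign L_one neq1 m3 l1 l2 gG).
Qed.
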